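(* Let $\{\varepsilon_i\}_{i=1}^\infty$ be a sequence of pairwise distinct real numbers with $0<\varepsilon_i<1/4$ for all $i$. For each integer $i\ge1$ let $L_i\subset\mathbb R_\infty^6$ be the tropical hyperplane consisting of all points $(x_1,x_2,y_1,y_2,z_1,z_2)\in\mathbb R_\infty^6$ at which the set $$\{-i+x_1,\ -i+x_2,\ -i/2-\varepsilon_i+y_1,\ -i/2+y_2,\ z_1,\ z_2\}$$ has at least two minimal elements, and let $M=\bigcap_{1\le i<\infty}L_i\subset\mathbb R_\infty^6$. Then the set $M\cap\mathbb R^6$ is not a finite union of convex polyhedra. In particular, $M$ is not a tropical prevariety.
   Context: $\mathbb R_\infty=\mathbb R\cup\{\infty\}$, with $a<\infty$ and $a+\infty=\infty$ for $a\in\mathbb R$, and $\infty+\infty=\infty$. ''At least two minimal elements'' means that the minimum of the six listed expressions is attained by at least two of them (counted by position in the list). A tropical prevariety is an intersection of finitely many tropical hypersurfaces, where a tropical hypersurface is the set of points at which the minimum among the monomials (expressions $a+\sum_\ell m_\ell u_\ell$ with $m_\ell\in\mathbb Z_{\ge0}$, $a\in\mathbb R_\infty$, in the coordinates $u_\ell$) of a tropical polynomial is attained at least twice. Convex polyhedra are sets in $\mathbb R^6$ defined by finitely many linear inequalities; they need not be bounded. *)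

(* Defs.v *)
From HB Require Import structures.
From mathcomp Require Import all_boot all_order all_algebra.
From mathcomp Require Import finmap.
From mathcomp Require Import boolp classical_sets reals ereal.

Set Implicit Arguments.
Unset Strict Implicit.
Unset Printing Implicit Defensive.

Import Order.TTheory GRing.Theory Num.Theory.

Local Open Scope classical_set_scope.
Local Open Scope ring_scope.

(* R ∪ {∞}, as the extended reals without -oo. Sums of such elements are
   computed in \bar R, where no conflict between +oo and -oo can arise. *)
Definition Rinfty (R : realType) : Type := {x : \bar R | (x != -oo)%E}.

Definition Rinfty_of (R : realType) (r : R) : Rinfty R :=
  exist (fun x : \bar R => (x != -oo)%E) r%:E isT.

(* A ∩ R^n, for A a subset of (R ∪ {∞})^n *)
Definition real_part (R : realType) (n : nat) (A : set 'rV[Rinfty R]_n) :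
    set 'rV[R]_n :=
  [set u | A (map_mx (@Rinfty_of R) u)].

Definition min_attained_twice (R : realType) (I : finType) (v : I -> \bar R) :
    Prop :=
  exists i j : I, [/\ i != j, v i = v j & forall k : I, (v i <= v k)%E].

(* Finite map from exponent vectors to coefficients: the monomials of a
   tropical polynomial have pairwise distinct exponent vectors. *)
Definition tropical_poly (R : realType) (n : nat) : Type :=
  {fmap {ffun 'I_n -> nat} -> Rinfty R}.

(* u *+ 0 = 0 also for u = +oo: a variable with exponent 0 does not occur. *)
Definition monomial_value (R : realType) (n : nat)
    (a : Rinfty R) (m : {ffun 'I_n -> nat}) (u : 'rV[Rinfty R]_n) : \bar R :=
  (val a + \sum_(l < n) val (u 0%R l) *+ m l)%E.

Definition tropical_hypersurface (R : realType) (n : nat)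
    (f : tropical_poly R n) : set 'rV[Rinfty R]_n :=
  [set u | min_attained_twice
             (fun m : domf f => monomial_value (f m) (val m) u)].

Definition tropical_prevariety (R : realType) (n : nat)
    (A : set 'rV[Rinfty R]_n) : Prop :=
  exists (k : nat) (f : 'I_k -> tropical_poly R n),
    A = \bigcap_i tropical_hypersurface (f i).

Definition tropical_hyperplane (R : realType) (n : nat) (c : 'rV[R]_n) :
    set 'rV[Rinfty R]_n :=
  [set u | min_attained_twice
             (fun l : 'I_n => ((c 0%R l)%:E + val (u 0%R l))%E)].

Definition convex_polyhedron (R : realType) (n : nat) (P : set 'rV[R]_n) :
    Prop :=
  exists (k : nat) (A : 'M[R]_(k, n)) (b : 'cV[R]_k),
    P = [set u | forall i : 'I_k, (A *m u^T) i 0 <= b i 0].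

Definition finite_union_of_polyhedra (R : realType) (n : nat)
    (A : set 'rV[R]_n) : Prop :=
  exists (k : nat) (P : 'I_k -> set 'rV[R]_n),
    (forall i : 'I_k, convex_polyhedron (P i)) /\ A = \bigcup_i P i.

(* Coordinates are ordered as (x1, x2, y1, y2, z1, z2). *)
Definition L_coeffs (R : realType) (eps : nat -> R) (i : nat) : 'rV[R]_6 :=
  \row_(l < 6) [:: - i%:R; - i%:R;
                   - (i%:R / 2) - eps i; - (i%:R / 2);
                   0; 0]`_l.

Definition L (R : realType) (eps : nat -> R) (i : nat) :
    set 'rV[Rinfty R]_6 :=
  tropical_hyperplane (L_coeffs eps i).

Definition M (R : realType) (eps : nat -> R) : set 'rV[Rinfty R]_6 :=
  \bigcap_(i in [set i : nat | (1 <= i)%N]) L eps i.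

(* Main.v *)
Require Import Defs.
From mathcomp Require Import all_boot all_order all_algebra.
From mathcomp Require Import finmap.
From mathcomp Require Import boolp classical_sets reals ereal.
From mathcomp Require Import zify ring lra.

Import Order.TTheory GRing.Theory Num.Theory.

Local Open Scope ring_scope.

(** The points p_k = (k, k, k/2 - 1/4 + eps_k, k/2 - 1/4, 0, 0), k >= 1, all lie
    in M: in L_i the minimum is attained by the two z's for i < k, by the two
    y's for i = k and by the two x's for i > k. If M were a finite union of
    convex sets, one of them would contain p_k and p_l with k < l. But close to
    p_k on the segment from p_k to p_l, the two y's are still strictly the
    smallest entries in L_k, and they differ because eps_k <> eps_l. A tropical
    prevariety is also a finite union of convex sets in R^n, one for each choice
    of a pair of minimal monomials in each of the defining polynomials. *)

Definition convex_cell {R : realType} {n : nat} (C : set 'rV[R]_n) : Prop :=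
  forall (u v : 'rV[R]_n) (a : R), 0 <= a <= 1 ->
    C u -> C v -> C ((1 - a) *: u + a *: v).

(** The weakening shared by polyhedral unions and prevarieties. Pieces are indexed by any [finType],
    so that choices of monomial pairs can serve as indices directly. *)
Definition finite_union_of_convex {R : realType} {n : nat}
    (A : set 'rV[R]_n) : Prop :=
  exists (T : finType) (C : T -> set 'rV[R]_n),
    (forall t, convex_cell (C t)) /\ A = (\bigcup_t C t)%classic.

Lemma convex_polyhedron_cell (R : realType) (n : nat) (P : set 'rV[R]_n) :
  convex_polyhedron P -> convex_cell P.
Proof.
move=> [k [A [b ->]]] u v a /andP[a0 a1] /= Pu Pv i.
rewrite linearD !linearZ /= mulmxDr -!scalemxAr !mxE.
have := Pu i; have := Pv i; rewrite !mxE.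
set s := \sum_j _; set t := \sum_j _; nra.
Qed.

Lemma finite_union_of_polyhedra_convex (R : realType) (n : nat)
    (A : set 'rV[R]_n) :
  finite_union_of_polyhedra A -> finite_union_of_convex A.
Proof.
move=> [k [P [Ppoly ->]]]; exists 'I_k, P; split=> // i.
exact: convex_polyhedron_cell.
Qed.

(** For finite [x] and [y] both sides are affine in the parameter. An infinite [x] or [y] absorbs
    every real summand, so the comparison is then the same at all points. *)
Lemma lee_convex (R : realType) (x y : \bar R) (r s r' s' a : R) :
  (x != -oo)%E -> (y != -oo)%E -> 0 <= a <= 1 ->
  (x + r%:E <= y + s%:E)%E -> (x + r'%:E <= y + s'%:E)%E ->
  (x + ((1 - a) * r + a * r')%:E <= y + ((1 - a) * s + a * s')%:E)%E.
Proof.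
case: x => [x| |] //; case: y => [y| |] // _ _ /andP[a0 a1].
- rewrite -!EFinD !lee_fin; nra.
- by move=> _ _; rewrite addye ?leey.
Qed.

Lemma monomial_value_real (R : realType) (n : nat) (a : Rinfty R)
    (m : {ffun 'I_n -> nat}) (u : 'rV[R]_n) :
  monomial_value a m (map_mx (@Rinfty_of R) u)
  = (val a + (\sum_(l < n) u 0 l *+ m l)%:E)%E.
Proof.
rewrite /monomial_value -sumEFin; congr (_ + _)%E.
by apply: eq_bigr => l _; rewrite mxE /= EFin_natmul.
Qed.

Lemma monomial_value_convex (R : realType) (n : nat) (a b : Rinfty R)
    (m m' : {ffun 'I_n -> nat}) (u v : 'rV[R]_n) (t : R) :
  0 <= t <= 1 ->
  (monomial_value a m (map_mx (@Rinfty_of R) u)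
   <= monomial_value b m' (map_mx (@Rinfty_of R) u))%E ->
  (monomial_value a m (map_mx (@Rinfty_of R) v)
   <= monomial_value b m' (map_mx (@Rinfty_of R) v))%E ->
  (monomial_value a m (map_mx (@Rinfty_of R) ((1 - t) *: u + t *: v))
   <= monomial_value b m' (map_mx (@Rinfty_of R) ((1 - t) *: u + t *: v)))%E.
Proof.
have sum_convex (p : {ffun 'I_n -> nat}) :
    \sum_(l < n) ((1 - t) *: u + t *: v) 0 l *+ p l =
    (1 - t) * (\sum_(l < n) u 0 l *+ p l) + t * (\sum_(l < n) v 0 l *+ p l).
  rewrite !mulr_sumr -big_split; apply: eq_bigr => l _.
  by rewrite !mxE /= mulrnDl !mulrnAr.
rewrite !monomial_value_real !sum_convex => t01.
by apply: lee_convex => //; [case: a|case: b].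
Qed.

Lemma tropical_prevariety_convex (R : realType) (n : nat)
    (A : set 'rV[Rinfty R]_n) :
  tropical_prevariety A -> finite_union_of_convex (real_part A).
Proof.
move=> [k [f ->]].
pose v (i : 'I_k) (u : 'rV[R]_n) (m : domf (f i)) :=
  monomial_value (f i m) (val m) (map_mx (@Rinfty_of R) u).
pose T := {dffun forall i : 'I_k, (domf (f i) * domf (f i))%type}.
pose C (t : T) : set 'rV[R]_n := fun u => forall i : 'I_k,
  [/\ (t i).1 != (t i).2, v i u (t i).1 = v i u (t i).2
    & forall m, (v i u (t i).1 <= v i u m)%E].
exists T, C; split=> [t u w a a01 Cu Cw i|].
  have [t12 eu lu] := Cu i; have [_ ew lw] := Cw i.
  have conv m m' : (v i u m <= v i u m')%E -> (v i w m <= v i w m')%E ->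
      (v i ((1 - a) *: u + a *: w)%R m <= v i ((1 - a) *: u + a *: w)%R m')%E.
    exact: monomial_value_convex.
  split=> // [|m]; last exact: conv.
  (* The tie is split into two inequalities, each of which passes to the segment. *)
  by apply/le_anti/andP; split; apply: conv; rewrite ?eu ?ew.
apply/seteqP; split=> u /=.
- move=> Au.
  have gP : forall i : 'I_k, exists p : domf (f i) * domf (f i),
      [/\ p.1 != p.2, v i u p.1 = v i u p.2
        & forall m, (v i u p.1 <= v i u m)%E].
    by move=> i; have [p [q pq]] := Au i I; exists (p, q).
  exists ([ffun i => sval (cid (gP i))] : T) => // i.
  by rewrite ffunE; case: cid.
- by move=> [t _ Ct] i _; exists (t i).1, (t i).2; exact: Ct.
Qed.

Lemma tropical_hyperplane_real (R : realType) (n : nat) (c u : 'rV[R]_n) :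
  tropical_hyperplane c (map_mx (@Rinfty_of R) u) <->
  exists i j : 'I_n, [/\ i != j, c 0 i + u 0 i = c 0 j + u 0 j
    & forall l : 'I_n, c 0 i + u 0 i <= c 0 l + u 0 l].
Proof.
split=> -[i [j [ij eij le_i]]]; exists i, j.
- split=> // [|l]; first by move: eij; rewrite !mxE /= -!EFinD => -[].
  by have := le_i l; rewrite !mxE /= -!EFinD lee_fin.
- split=> // [|l]; first by rewrite !mxE /= -!EFinD eij.
  by rewrite !mxE /= -!EFinD lee_fin le_i.
Qed.

Definition witness {R : realType} (eps : nat -> R) (k : nat) : 'rV[R]_6 :=
  \row_(l < 6) [:: k%:R; k%:R; k%:R / 2 - 1 / 4 + eps k; k%:R / 2 - 1 / 4;
                   0; 0]`_l.

Section Witness.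
Variables (R : realType) (eps : nat -> R).
Hypothesis eps_inj : forall i j : nat, (1 <= i)%N -> (1 <= j)%N -> i <> j ->
  eps i <> eps j.
Hypothesis eps_bounds : forall i : nat, (1 <= i)%N -> 0 < eps i < 1 / 4.

(** With d = k - i, the entries of L_i at p_k are d, d, d/2 - 1/4 + eps_k - eps_i, d/2 - 1/4, 0, 0.
    For d = 0 the shift by -1/4 puts the tied y's below 0; for |d| >= 1 the bound |eps_k - eps_i| <
    1/4 keeps both y's above min(d, 0). *)
Lemma witness_in_M (k : nat) : (1 <= k)%N -> real_part (M eps) (witness eps k).
Proof.
move=> k1 i /= i1; apply/tropical_hyperplane_real.
have /andP[ek0 ek1] := eps_bounds k k1; have /andP[ei0 ei1] := eps_bounds i i1.
case: (ltngtP i k) => [ik|ki|->].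
- have {}ik : i%:R + 1 <= k%:R :> R by rewrite natr1 ler_nat.
  exists (Ordinal (isT : (4 < 6)%N)), (Ordinal (isT : (5 < 6)%N)).
  split=> [//||]; first by rewrite !mxE.
  by case=> [[|[|[|[|[|[|//]]]]]] ?]; rewrite !mxE /=; lra.
- have {}ki : k%:R + 1 <= i%:R :> R by rewrite natr1 ler_nat.
  exists (Ordinal (isT : (0 < 6)%N)), (Ordinal (isT : (1 < 6)%N)).
  split=> [//||]; first by rewrite !mxE.
  by case=> [[|[|[|[|[|[|//]]]]]] ?]; rewrite !mxE /=; lra.
- exists (Ordinal (isT : (2 < 6)%N)), (Ordinal (isT : (3 < 6)%N)).
  split=> [//||]; first by rewrite !mxE /=; lra.
  by case=> [[|[|[|[|[|[|//]]]]]] ?]; rewrite !mxE /=; lra.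
Qed.

(** This [a] makes a(l - k) = 1/4, so the entries of L_k become 1/4, 1/4, -1/8 + a(eps_l - eps_k),
    -1/8, 0, 0. The perturbation is nonzero and smaller than 1/16 in absolute value, hence the
    minimum is attained only once. *)
Lemma witness_segment_not_in_M (k l : nat) (a : R) :
    (1 <= k)%N -> (k < l)%N -> a = (4 * (l%:R - k%:R))^-1 ->
  ~ real_part (M eps) ((1 - a) *: witness eps k + a *: witness eps l).
Proof.
move=> k1 kl aE /(_ k k1) /tropical_hyperplane_real.
have l1 : (1 <= l)%N by lia.
have /andP[ek0 ek1] := eps_bounds k k1; have /andP[el0 el1] := eps_bounds l l1.
have kl1 : k%:R + 1 <= l%:R :> R by rewrite natr1 ler_nat.
have a_lk : a * l%:R = a * k%:R + 1 / 4 by rewrite aE; field; lra.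
have a0 : 0 < a by rewrite aE invr_gt0; lra.
have a1 : a <= 1 / 4 by nra.
have ael : 0 < a * eps l < 1 / 16 by apply/andP; split; nra.
have aek : 0 < a * eps k < 1 / 16 by apply/andP; split; nra.
have ne : a * eps k <> a * eps l.
  by move/(mulfI (lt0r_neq0 a0)); apply: eps_inj => //; lia.
move=> [i [j [ij eij le_i]]].
have := le_i (Ordinal (isT : (2 < 6)%N)).
have := le_i (Ordinal (isT : (3 < 6)%N)).
move: ij eij {le_i}.
(* Any pair other than the two y's contradicts the bounds; a tie of the y's would give a eps_k = a
   eps_l. *)
by case: i => [[|[|[|[|[|[|//]]]]]] ?];
   case: j => [[|[|[|[|[|[|//]]]]]] ?] //; rewrite !mxE /= => _;
   try (by lra); move=> eij; exfalso; apply: ne; lra.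
Qed.

Lemma M_not_finite_union_of_convex :
  ~ finite_union_of_convex (real_part (M eps)).
Proof.
move=> [T [C [Cconv ME]]].
(* Shifted by one, since the witnesses start at index 1. *)
have /choice [c cP] : forall k : nat, exists t : T, C t (witness eps k.+1).
  by move=> k; have := witness_in_M k.+1 isT; rewrite ME => -[t _]; exists t.
have no_segment (k l : nat) : (k < l)%N -> c k = c l -> False.
  move=> kl ckl; have kl1 : k%:R + 1 <= l%:R :> R by rewrite natr1 ler_nat.
  apply: (witness_segment_not_in_M k.+1 l.+1 _ isT _ erefl) => //.
  rewrite ME; exists (c k) => //; apply: Cconv; first last.
  - by rewrite ckl.
  - exact: cP.
  rewrite -!natr1 invr_ge0 invf_le1; lra.
(* Pigeonhole: no two witnesses share a piece, yet there are more of them than the #|T| pieces. *)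
have /leq_card : injective (fun i : 'I_#|T|.+1 => c i).
  by move=> i j cij; apply/val_inj; case: (ltngtP i j) => // ij;
     [case: (no_segment _ _ ij)|case: (no_segment _ _ ij)].
by rewrite card_ord ltnn.
Qed.

End Witness.

Theorem proposition4p1 (R : realType) (eps : nat -> R)
    (eps_inj : forall i j : nat, (1 <= i)%N -> (1 <= j)%N -> i <> j ->
       eps i <> eps j)
    (eps_bounds : forall i : nat, (1 <= i)%N -> 0 < eps i < 1 / 4) :
  ~ finite_union_of_polyhedra (real_part (M eps)) /\
  ~ tropical_prevariety (M eps).
Proof.
have notM := M_not_finite_union_of_convex R eps eps_inj eps_bounds.
split=> [/finite_union_of_polyhedra_convex|/tropical_prevariety_convex];
  exact: notM.
Qed.
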